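(* The variety of Stone algebras is non-negative universally complete but not universally complete, and the set $\{\top\approx\bot\Rightarrow\emptyset\}$ is a basis for the admissible clauses of this variety.
   Context: A Stone algebra is an algebra $(A,\vee,\wedge,{}^{*},\bot,\top)$ such that $(A,\vee,\wedge,\bot,\top)$ is a bounded distributive lattice, $a^{*}=\max\{b\in A\mid a\wedge b=\bot\}$ and $a^{*}\vee a^{**}=\top$ for all $a\in A$. A clause is a pair $\Sigma\Rightarrow\Delta$ of finite (possibly empty) sets of identities; it is non-negative if $\Delta\neq\emptyset$. It is satisfied by an algebra if every assignment of the variables making all identities in $\Sigma$ true makes at least one identity in $\Delta$ true (so $\Sigma\Rightarrow\emptyset$ means that no assignment makes all of $\Sigma$ true), and valid in a class if all members satisfy it. A clause $\Sigma\Rightarrow\Delta$ is admissible in a quasivariety $\mathcal{Q}$ if for every substitution $\sigma$ (endomorphism of the algebra of formulas over countably infinitely many variables) such that $\sigma(\varphi')\approx\sigma(\psi')$ is valid in $\mathcal{Q}$ for all $\varphi'\approx\psi'\in\Sigma$, the identity $\sigma(\varphi)\approx\sigma(\psi)$ is valid in $\mathcal{Q}$ for some $\varphi\approx\psi\in\Delta$. $\mathcal{Q}$ is universally complete (resp. non-negative universally complete) if each clause (resp. each non-negative clause) is admissible in $\mathcal{Q}$ exactly when it is valid in $\mathcal{Q}$. A universal class is the class of all algebras of the language satisfying some set of clauses; $\mathbb{U}(\mathcal{K})$ is the smallest universal class containing $\mathcal{K}$. $\mathbf{F}_{\mathcal{Q}}$ is the free algebra of $\mathcal{Q}$ on countably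 infinitely many generators. A set $\Lambda$ of clauses is a basis for the admissible clauses of $\mathcal{Q}$ if for every algebra $\mathbf{A}$: $\mathbf{A}\in\mathbb{U}(\mathbf{F}_{\mathcal{Q}})$ iff $\mathbf{A}\in\mathcal{Q}$ and $\mathbf{A}$ satisfies all clauses in $\Lambda$. *)

(* Defs.v *)
From HB Require Import structures.
From mathcomp Require Import all_boot generic_quotient finmap.
From mathcomp Require Import boolp classical_sets.

Set Implicit Arguments.
Unset Strict Implicit.
Unset Printing Implicit Defensive.

Local Open Scope fset_scope.
Local Open Scope classical_set_scope.
Local Open Scope quotient_scope.

Record algebra : Type := Algebra {
  carrier :> Type;
  join : carrier -> carrier -> carrier;
  meet : carrier -> carrier -> carrier;
  star : carrier -> carrier;
  bot : carrier;
  top : carrier }.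

Arguments join {a} _ _.
Arguments meet {a} _ _.
Arguments star {a} _.
Arguments bot {a}.
Arguments top {a}.

(* Not [set algebra]: that would put the universe of carriers strictly below
   the one of choice types, in which the quotient [free_algebra] lives. *)
Definition class : Type := algebra -> Prop.

Definition homomorphism (A B : algebra) (h : A -> B) : Prop :=
  [/\ {morph h : x y / join x y}, {morph h : x y / meet x y},
      {morph h : x / star x}, h bot = bot & h top = top].

Definition lattice_le (A : algebra) (a b : A) : Prop := meet a b = a.

Record bounded_distributive_lattice (A : algebra) : Prop := {
  joinC : commutative (@join A);
  meetC : commutative (@meet A);
  joinA : associative (@join A);
  meetA : associative (@meet A);
  joinK : forall a b : A, join a (meet a b) = a;
  meetK : forall a b : A, meet a (join a b) = a;
  meet_joinr : right_distributive (@meet A) join;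
  join_bot : right_id bot (@join A);
  meet_top : right_id top (@meet A) }.

Record stone_algebra (A : algebra) : Prop := {
  stone_lattice : bounded_distributive_lattice A;
  meet_star : forall a : A, meet a (star a) = bot;
  star_max : forall a b : A, meet a b = bot -> lattice_le b (star a);
  stone_join : forall a : A, join (star a) (star (star a)) = top }.

Inductive term : Type :=
| Var of nat
| Join of term & term
| Meet of term & term
| Star of term
| Bot
| Top.

HB.instance Definition _ := gen_eqMixin term.
HB.instance Definition _ := gen_choiceMixin term.

Definition term_algebra : algebra := Algebra Join Meet Star Bot Top.

Fixpoint eval (A : algebra) (v : nat -> A) (t : term) : A :=
  match t with
  | Var i => v i
  | Join s t => join (eval v s) (eval v t)
  | Meet s t => meet (eval v s) (eval v t)
  | Star s => star (eval v s)
  | Bot => bot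
  | Top => top
  end.

Definition identity : Type := (term * term)%type.

Definition holds (A : algebra) (v : nat -> A) (e : identity) : Prop :=
  eval v e.1 = eval v e.2.

Record clause : Type := Clause {
  premises : {fset identity};
  conclusions : {fset identity} }.

Definition nonnegative (c : clause) : Prop := conclusions c != fset0.

Definition satisfies (A : algebra) (c : clause) : Prop :=
  forall v : nat -> A,
    (forall e, e \in premises c -> holds v e) ->
    exists2 e, e \in conclusions c & holds v e.

Definition valid (Q : class) (c : clause) : Prop :=
  forall A, Q A -> satisfies A c.

Definition valid_identity (Q : class) (e : identity) : Prop :=
  forall A, Q A -> forall v : nat -> A, holds v e.

Definition admissible (Q : class) (c : clause) : Prop :=
  forall sigma : term_algebra -> term_algebra,
    homomorphism sigma ->
    (forall e, e \in premises c -> valid_identity Q (sigma e.1, sigma e.2)) ->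
    exists2 e, e \in conclusions c & valid_identity Q (sigma e.1, sigma e.2).

Definition universally_complete (Q : class) : Prop :=
  forall c, admissible Q c <-> valid Q c.

Definition nonneg_universally_complete (Q : class) : Prop :=
  forall c, nonnegative c -> (admissible Q c <-> valid Q c).

Definition universal_class (C : class) : Prop :=
  exists Lambda : set clause,
    forall A, C A <-> forall c, Lambda c -> satisfies A c.

Definition U (K : class) : class := fun A =>
  forall C : class,
    universal_class C -> (forall B, K B -> C B) -> C A.

Lemma term_eqv_class (Q : class) :
  equiv_class_of (fun s t : term => `[< valid_identity Q (s, t) >]).
Proof.
split=> [t|s t|t s u]; first exact/asboolP.
- by apply/asboolP/asboolP => Qst A QA v; rewrite /holds (Qst A QA v).
- move=> /asboolP Qst /asboolP Qtu; apply/asboolP => A QA v.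
  exact: etrans (Qst A QA v) (Qtu A QA v).
Qed.

Definition term_eqv (Q : class) : equiv_rel term :=
  EquivRelPack (term_eqv_class Q).

(* The free algebra of Q on countably many generators, as the quotient of the
   term algebra by the congruence of identities valid in Q; the generators are
   the classes of the variables.  Operations act on chosen representatives,
   which is harmless as the relation is a congruence (free_algebra_pi). *)
Definition free_algebra (Q : class) : algebra :=
  @Algebra {eq_quot term_eqv Q}
    (fun x y => \pi_{eq_quot term_eqv Q} (Join (repr x) (repr y)))
    (fun x y => \pi_{eq_quot term_eqv Q} (Meet (repr x) (repr y)))
    (fun x => \pi_{eq_quot term_eqv Q} (Star (repr x)))
    (\pi_{eq_quot term_eqv Q} Bot)
    (\pi_{eq_quot term_eqv Q} Top).

Lemma free_algebra_pi (Q : class) :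
  @homomorphism term_algebra (free_algebra Q) \pi_{eq_quot term_eqv Q}.
Proof.
have reprP t : valid_identity Q (t, repr (\pi_{eq_quot term_eqv Q} t)).
  by apply/asboolP/(eqmodP (term_eqv Q)); rewrite reprK.
split=> //= [s t|s t|s]; apply/eqmodP/asboolP => A QA v.
- by congr join; apply: reprP QA v.
- by congr meet; apply: reprP QA v.
- by congr star; apply: reprP QA v.
Qed.

Definition admissible_basis (Q : class) (Lambda : set clause) : Prop :=
  forall A : algebra,
    U (eq (free_algebra Q)) A <-> Q A /\ forall c, Lambda c -> satisfies A c.

(* Main.v *)
(** The three-element chain 0 < 1/2 < 1 separates the points of every Stone
    algebra: a prime filter P yields the homomorphism sending x to 1 if x is in
    P, to 1/2 if only x** is, and to 0 otherwise.  Let an assignment v into a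
    non-trivial Stone algebra satisfy the premises of a clause but none of its
    conclusions.  Composing v with separating homomorphisms gives assignments
    w_0, ..., w_n into the chain which satisfy the premises and together refute
    all conclusions (a homomorphism exists even if there is no conclusion, by
    non-triviality).  One substitution encodes all w_i: dense and complemented
    formulas let an assignment of fresh variables select an index i and a value
    1/2 or 1 for a dense formula; the substitution then evaluates to w_i, or to
    w_i with 1/2 collapsed to 1, which is again an endomorphic image of w_i.
    So it unifies the premises and no conclusion, and the clause is not
    admissible.  Hence a non-trivial Stone algebra satisfies all admissible
    clauses, which are those satisfied by the free algebra. *)
Require Import Defs.
From mathcomp Require Import all_boot generic_quotient finmap.
From mathcomp Require Import boolp classical_sets.

Set Implicit Arguments.
Unset Strict Implicit.
Unset Printing Implicit Defensive.

Local Open Scope quotient_scope.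

(** * Evaluation under homomorphisms and the lattice order *)

Lemma eval_hom (A B : algebra) (h : A -> B) (v : nat -> A) (t : term) :
  homomorphism h -> h (eval v t) = eval (h \o v) t.
Proof.
case=> hj hm hs h0 h1.
by elim: t => //= [s <- t <-|s <- t <-|s <-]; rewrite ?hj ?hm ?hs.
Qed.

Lemma eval_homomorphism (A : algebra) (v : nat -> A) :
  @homomorphism term_algebra A (eval v).
Proof. by []. Qed.

Lemma holds_hom (A B : algebra) (h : A -> B) (v : nat -> A) (e : identity) :
  homomorphism h -> holds v e -> holds (h \o v) e.
Proof. by move=> hh; rewrite /holds -!eval_hom // => ->. Qed.

Lemma le_trans (A : algebra) (L : bounded_distributive_lattice A) (b a c : A) :
  lattice_le a b -> lattice_le b c -> lattice_le a c.
Proof. by rewrite /lattice_le => ab bc; rewrite -ab -(meetA L) bc. Qed.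

Lemma meetxx (A : algebra) (L : bounded_distributive_lattice A) (a : A) :
  meet a a = a.
Proof. by rewrite -{2}(joinK L a a) (meetK L). Qed.

Lemma le_meetl (A : algebra) (L : bounded_distributive_lattice A) (a b : A) :
  lattice_le (meet a b) a.
Proof. by rewrite /lattice_le (meetC L _ a) (meetA L) meetxx. Qed.

Lemma le_meetr (A : algebra) (L : bounded_distributive_lattice A) (a b : A) :
  lattice_le (meet a b) b.
Proof. by rewrite /lattice_le -(meetA L) meetxx. Qed.

Lemma le_meet (A : algebra) (L : bounded_distributive_lattice A) (a b c : A) :
  lattice_le c a -> lattice_le c b -> lattice_le c (meet a b).
Proof. by rewrite /lattice_le => ca cb; rewrite (meetA L) ca cb. Qed.

Lemma join_le (A : algebra) (L : bounded_distributive_lattice A) (a b c : A) :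
  lattice_le a c -> lattice_le b c -> lattice_le (join a b) c.
Proof.
rewrite /lattice_le => ac bc.
by rewrite (meetC L) (meet_joinr L) !(meetC L c) ac bc.
Qed.

Lemma le_joinl (A : algebra) (L : bounded_distributive_lattice A) (a b : A) :
  lattice_le a (join a b).
Proof. exact: meetK. Qed.

Lemma le_joinr (A : algebra) (L : bounded_distributive_lattice A) (a b : A) :
  lattice_le b (join a b).
Proof. by rewrite (joinC L); exact: meetK. Qed.

Lemma le_anti (A : algebra) (L : bounded_distributive_lattice A) (a b : A) :
  lattice_le a b -> lattice_le b a -> a = b.
Proof. by rewrite /lattice_le => ab ba; rewrite -ab (meetC L). Qed.

Lemma meet_bot (A : algebra) (L : bounded_distributive_lattice A) (a : A) :
  meet a bot = bot.
Proof.
by rewrite (meetC L) -[X in meet _ X](join_bot L) (joinC L) (meetK L).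
Qed.

Lemma le_top (A : algebra) (L : bounded_distributive_lattice A) (a : A) :
  lattice_le a top.
Proof. exact: meet_top. Qed.

Lemma eq_trivial (A : algebra) (L : bounded_distributive_lattice A) (a b : A) :
  top = bot :> A -> a = b.
Proof.
move=> tb; suff e (c : A) : c = bot by rewrite (e a) (e b).
by rewrite -(meet_top L c) tb meet_bot.
Qed.

(** * Prime filters *)

Record prime_filter (A : algebra) (P : A -> Prop) : Prop := {
  prime_up : forall a b : A, lattice_le a b -> P a -> P b;
  prime_meet : forall a b : A, P a -> P b -> P (meet a b);
  prime_join : forall a b : A, P (join a b) -> P a \/ P b;
  prime_top : P top;
  prime_bot : ~ P bot }.

(** Zorn's lemma gives a filter [X] maximal among those avoiding [b]. If [x] and [y] both lie
    outside [X], adjoining either one reaches [b]; by distributivity [x] join [y] then reaches [b]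
    too, so [X] is prime. *)
Lemma prime_filter_separation (A : algebra) (a b : A) :
  bounded_distributive_lattice A -> ~ lattice_le a b ->
  exists P : A -> Prop, [/\ prime_filter P, P a & ~ P b].
Proof.
move=> L nab.
(* Non-emptiness is a premise in the last conjunct because Zorn's lemma is
   also applied to the empty chain. *)
pose good (X : set A) :=
  [/\ forall x y, lattice_le x y -> X x -> X y,
      forall x y, X x -> X y -> X (meet x y), ~ X b
    & forall x, X x -> X a].
have [F FG Ftot|X [[Xup Xmeet Xb Xa] Xmax]] := @Zorn_bigcup A good.
  split=> [x y xy [Y FY Yx]|x y [Y FY Yx] [Z FZ Zy]|[Y FY]|x [Y FY Yx]].
  - by exists Y => //; have [up _ _ _] := FG Y FY; exact: up xy Yx.
  - have [YZ|ZY] := Ftot Y Z FY FZ.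
    + by exists Z => //; have [_ m _ _] := FG Z FZ; apply: m => //; exact: YZ.
    + by exists Y => //; have [_ m _ _] := FG Y FY; apply: m => //; exact: ZY.
  - by have [_ _ nb _] := FG Y FY.
  - by exists Y => //; have [_ _ _ ha] := FG Y FY; exact: ha Yx.
have aX : X a.
  (* Without [a], the set [X] would be empty and the principal filter of [a] would properly extend
     it. *)
  apply: contrapT => nXa; apply: (Xmax (fun x => lattice_le a x)).
    split=> [x /Xa //|/(_ a (meetxx L a)) //].
  split=> // [x y xy ax|x y|x _]; [exact: le_trans xy|exact: le_meet|exact: meetxx].
have ext x : ~ X x -> exists2 p, X p & lattice_le (meet p x) b.
  move=> nXx; apply: contrapT => nb.
  (* The filter generated by [X] and [x]. *)
  apply: (Xmax (fun y => exists2 p, X p & lattice_le (meet p x) y)).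
    split=> [y Xy|sub]; first by exists y => //; exact: le_meetl.
    by apply: nXx; apply: sub; exists a => //; exact: le_meetr.
  split=> // [y z yz [p Xp py]|y z [p Xp py] [q Xq qz]|_ _].
  - by exists p => //; exact: le_trans yz.
  - exists (meet p q); first exact: Xmeet.
    apply: le_meet => //.
    + apply: (le_trans L) py; apply: le_meet => //; last exact: le_meetr.
      by apply: (le_trans L) (le_meetl L _ _); exact: le_meetl.
    + apply: (le_trans L) qz; apply: le_meet => //; last exact: le_meetr.
      by apply: (le_trans L) (le_meetr L p q); exact: le_meetl.
  - by exists a => //; exact: le_meetl.
exists X; split=> //; split=> // [x y Xxy||Xbot].
- apply: contrapT => /not_orP[/ext[p Xp px] /ext[q Xq qy]]; apply: Xb.
  apply: (Xup (meet (meet p q) (join x y))); last by apply: (Xmeet _ _ _ Xxy); exact: Xmeet.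
  rewrite (meet_joinr L); apply: join_le => //.
  + apply: (le_trans L) px; apply: le_meet => //; last exact: le_meetr.
    by apply: (le_trans L) (le_meetl L p q); exact: le_meetl.
  + apply: (le_trans L) qy; apply: le_meet => //; last exact: le_meetr.
    by apply: (le_trans L) (le_meetr L p q); exact: le_meetl.
- by apply: Xup aX; exact: le_top.
- by apply: Xb; apply: Xup Xbot; rewrite /lattice_le (meetC L) meet_bot.
Qed.

(** * Laws of the pseudocomplement *)

Lemma le_star (A : algebra) (S : stone_algebra A) (a b : A) :
  lattice_le a b -> lattice_le (star b) (star a).
Proof.
have L := stone_lattice S => ab; apply: (star_max S).
by rewrite -ab -(meetA L) (meet_star S) meet_bot.
Qed.

Lemma le_starstar (A : algebra) (S : stone_algebra A) (a : A) :
  lattice_le a (star (star a)).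
Proof.
by apply: (star_max S); rewrite (meetC (stone_lattice S)) (meet_star S).
Qed.

Lemma starK3 (A : algebra) (S : stone_algebra A) (a : A) :
  star (star (star a)) = star a.
Proof.
apply: (le_anti (stone_lattice S)); last exact: le_starstar.
by apply: le_star => //; exact: le_starstar.
Qed.

Lemma meet_starstar_le (A : algebra) (S : stone_algebra A) (a b : A) :
  lattice_le (meet (star (star a)) (star (star b))) (star (star (meet a b))).
Proof.
have L := stone_lattice S; apply: (star_max S).
set c := star (meet a b).
have e1 : lattice_le (meet c a) (star b).
  by apply: (star_max S); rewrite (meetC L b) -(meetA L) (meetC L) (meet_star S).
have e2 : lattice_le (meet c (star (star b))) (star a).
  apply: (star_max S); rewrite (meetA L) (meetC L a) -e1 -(meetA L).
  by rewrite (meet_star S) meet_bot.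
rewrite (meetC L (star (star a))) (meetA L) -e2 -(meetA L).
by rewrite (meet_star S) meet_bot.
Qed.

Lemma star_join_ge (A : algebra) (S : stone_algebra A) (a b : A) :
  lattice_le (meet (star a) (star b)) (star (join a b)).
Proof.
have L := stone_lattice S; apply: (star_max S).
rewrite (meetC L) (meet_joinr L) -(meetA L) (meetC L (star b)) (meetA L).
rewrite (meetC L (star a) a) (meet_star S) (meetC L bot) meet_bot //.
by rewrite -(meetA L) (meetC L _ b) (meet_star S) meet_bot // (join_bot L).
Qed.

(** * The three-element chain and separation of points *)

Inductive chain3 : Type := Zero | Half | One.

Definition chain3_join (x y : chain3) : chain3 :=
  match x, y with
  | One, _ | _, One => One
  | Half, _ | _, Half => Half
  | _, _ => Zero
  end.

Definition chain3_meet (x y : chain3) : chain3 :=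
  match x, y with
  | Zero, _ | _, Zero => Zero
  | Half, _ | _, Half => Half
  | _, _ => One
  end.

Definition chain3_star (x : chain3) : chain3 := if x is Zero then One else Zero.

Definition three : algebra :=
  Algebra chain3_join chain3_meet chain3_star Zero One.

Lemma stone_three : stone_algebra three.
Proof. by split; [split|..]; do ?case. Qed.

Definition prime_map (A : algebra) (P : A -> Prop) (x : A) : three :=
  if `[< P x >] then One else if `[< P (star (star x)) >] then Half else Zero.

(** The map is determined by the nested sets [P] (value [One]) and [M] (value not [Zero]). Both
    commute with meets and joins, and the Stone identity makes [P (star x)] the negation of
    [M x]. *)
Lemma prime_map_hom (A : algebra) (P : A -> Prop) :
  stone_algebra A -> prime_filter P -> homomorphism (prime_map P).
Proof.
move=> S PP; have L := stone_lattice S.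
have [up Pm Pj P1 P0] := PP.
pose M x := P (star (star x)).
have PM x : P x -> M x by apply: up; exact: le_starstar.
have Mup x y : lattice_le x y -> M x -> M y.
  by move=> xy; apply: up; do 2!apply: le_star => //.
have MN x : ~ P (star x) <-> M x.
  split=> [nP|Mx Px]; first by case: (Pj (star x) (star (star x)));
    rewrite ?(stone_join S).
  by apply: P0; rewrite -(meet_star S (star x)); exact: Pm.
have PI x y : P (meet x y) <-> P x /\ P y.
  split=> [H|[]]; last exact: Pm.
  by split; apply: up H; [exact: le_meetl|exact: le_meetr].
have PU x y : P (join x y) <-> P x \/ P y.
  by split=> [/Pj//|[]]; apply: up; [exact: le_joinl|exact: le_joinr].
have MI x y : M (meet x y) <-> M x /\ M y.
  split=> [H|[Mx My]].
    by split; apply: Mup H; [exact: le_meetl|exact: le_meetr].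
  by apply: up (meet_starstar_le S x y) _; exact: Pm.
have MU x y : M (join x y) <-> M x \/ M y.
  split=> [/MN H|[]]; last 2 first.
  - by apply: Mup; exact: le_joinl.
  - by apply: Mup; exact: le_joinr.
  apply: contrapT => /not_orP[/MN nx /MN ny]; apply: H.
  apply: up (star_join_ge S x y) _.
  by apply: Pm; apply: contrapT.
have MS x : M (star x) <-> P (star x) by rewrite /M starK3.
have val x : prime_map P x =
  if `[< P x >] then One else if `[< M x >] then Half else Zero by [].
split=> /= [x y|x y|x||]; rewrite !val.
- rewrite (propext (PU x y)) (propext (MU x y)) !asbool_or.
  have := PM x; have := PM y.
  by do 4![case: asboolP => ?] => //=; tauto.
- rewrite (propext (PI x y)) (propext (MI x y)) !asbool_and.
  have := PM x; have := PM y.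
  by do 4![case: asboolP => ?] => //=; tauto.
- rewrite (propext (MS x)); have := MN x; have := PM x.
  by do ?[case: asboolP => ?] => //=; tauto.
- do 2!case: asboolP => //.
  by move=> /MN[]; apply: up P1; apply: (star_max S); rewrite (meetC L) meet_bot.
- by rewrite asboolT.
Qed.

Lemma three_separation (A : algebra) (a b : A) :
  stone_algebra A -> a <> b ->
  exists2 h : A -> three, homomorphism h & h a <> h b.
Proof.
move=> S nab; have L := stone_lattice S.
have sep c d : ~ lattice_le c d ->
    exists2 h : A -> three, homomorphism h & h c <> h d.
  move=> /(prime_filter_separation L)[P [PP Pc nPd]].
  exists (prime_map P); first exact: prime_map_hom.
  by rewrite /prime_map asboolT // asboolF //; case: asboolP.
have [ab|] := pselect (lattice_le a b); last exact: sep.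
have [|h hh ne] := @sep b a; last by exists h => //; exact: nesym.
by move=> ba; apply: nab; exact: le_anti ab ba.
Qed.

(** * Encoding finitely many chain assignments in one substitution *)

Lemma valid_three (e : identity) :
  (forall u : nat -> three, holds u e) -> valid_identity stone_algebra e.
Proof.
move=> H A S v; apply: contrapT => /(three_separation S)[h hh].
by rewrite !eval_hom //; apply; exact: H.
Qed.

(* [Join (Var 0) (Star (Var 0))] is dense: in the chain it takes exactly the
   values 1/2 and 1. *)
Definition chain3_code (x : chain3) : term :=
  match x with
  | Zero => Bot
  | Half => Join (Var 0) (Star (Var 0))
  | One => Top
  end.

(* In the chain, [Star (Star (Var i))] is a Boolean switch: the largest [i] in
   [1 .. n] whose switch is on selects [W i], and [W 0] is the default. *)
Fixpoint glue (W : nat -> nat -> three) (n x : nat) : term :=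
  if n is m.+1 then
    Join (Meet (Star (Star (Var n))) (chain3_code (W n x)))
         (Meet (Star (Var n)) (glue W m x))
  else chain3_code (W 0 x).

(** The switches determine [i] and [u 0] determines [f]: the identity if [u 0] is [Half], and
    otherwise the collapse of [Half] to [One]. *)
Lemma glue_eval (W : nat -> nat -> three) (n : nat) (u : nat -> three) :
  exists (f : three -> three) (i : nat),
    homomorphism f /\ forall x, eval u (glue W n x) = f (W i x).
Proof.
pose f (y : three) : three := eval u (chain3_code y).
have hf : homomorphism f.
  by rewrite /f; case eu0: (u 0); split;
    do ?case; rewrite /= ?eu0.
exists f; elim: n => [|n [i [_ IH]]]; first by exists 0.
have [un|un] := pselect (u n.+1 = Zero).
- exists i; split=> // x /=; rewrite un IH /=.
  by case: (f (W i x)).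
- exists n.+1; split=> // x /=; rewrite -/(f _).
  by case: (u n.+1) un => //= _; case: (f _).
Qed.

Lemma glue_onto (W : nat -> nat -> three) (n i : nat) :
  i <= n ->
  exists u : nat -> three, forall x, eval u (glue W n x) = W i x.
Proof.
(* [Half] at variable 0 makes every code evaluate to itself. For [i = 0] no switch is on, which
   leaves the default [W 0]. *)
move=> le_in; pose u k : three :=
  if k == 0 then Half else if k == i then One else Zero.
exists u => x.
have code y : eval u (chain3_code y) = y by case: y.
elim: n le_in => [|n IH] /=; first by rewrite leqn0 => /eqP ->.
have -> : u n.+1 = if n.+1 == i then One else Zero by [].
rewrite leq_eqVlt eq_sym code.
case: eqP => [<- _|_ /= lt_in]; first by case: (W n.+1 x).
by rewrite IH //; case: (W i x).
Qed.

Lemma admissible_satisfies (A : algebra) (c : clause) :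
  stone_algebra A -> top <> bot :> A ->
  admissible stone_algebra c -> satisfies A c.
Proof.
move=> S ntriv adm v Sv; apply: contrapT => nD.
have /choice[H HP] (e : identity) : exists h : A -> three,
    homomorphism h /\ (~ holds v e -> ~ holds (h \o v) e).
  have [he|he] := pselect (holds v e).
    (* Here any homomorphism will do; separating [top] from [bot] provides one. *)
    by have [h hh _] := three_separation S ntriv; exists h.
  have [h hh ne] := three_separation S he; exists h; split=> // _.
  by rewrite /holds -!eval_hom.
pose s : seq identity := enum_fset (conclusions c).
(* The index [size s] falls on the default [(Top, Bot)], so there is an assignment to glue even if
   [s] is empty. *)
pose W i x := H (nth (Top, Bot) s i) (v x).
pose sigma : term_algebra -> term_algebra :=
  @eval term_algebra (glue W (size s)).
have sigmaE (u : nat -> three) t :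
    eval u (sigma t) = eval (fun x => eval u (glue W (size s) x)) t.
  exact: (eval_hom (A := term_algebra)).
case: (adm sigma) => // [e Ee|e Ee].
  apply: valid_three => u; rewrite /holds /= !sigmaE.
  have [f [i [hf /funext ->]]] := glue_eval W (size s) u.
  have := holds_hom hf (holds_hom (HP (nth (Top, Bot) s i)).1 (Sv e Ee)).
  exact.
have es : e \in s by [].
have [u uE] := @glue_onto W (size s) (index e s) (index_size e s).
move=> /(_ three stone_three u); rewrite /holds /= !sigmaE (funext uE) => he.
apply: (HP e).2 => [hv|]; first by apply: nD; exists e.
by move: he; rewrite /W nth_index.
Qed.

(** * Clauses in the free algebra *)

Lemma free_valid (Q : class) (s t : term) :
  \pi_{eq_quot term_eqv Q} s = \pi_{eq_quot term_eqv Q} t <->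
  valid_identity Q (s, t).
Proof.
split=> [/eqmodP/asboolP //|H].
by apply/eqmodP/asboolP.
Qed.

(** Through representatives, an assignment into the free algebra is a substitution [s]. The premise
    then says that the [s]-image of [p] is valid in [Q], and the quasi-identity applies to [s]
    followed by any assignment into a member. *)
Lemma free_quasi_identity (Q : class) (p q : identity) :
  (forall A, Q A -> forall v : nat -> A, holds v p -> holds v q) ->
  forall v : nat -> free_algebra Q, holds v p -> holds v q.
Proof.
move=> H v; set s : nat -> term_algebra := fun i => repr (v i).
have -> : v = \pi_{eq_quot term_eqv Q} \o s.
  by apply/funext => i; rewrite /s /= reprK.
have ev t : eval (\pi_{eq_quot term_eqv Q} \o s : nat -> free_algebra Q) t =
    \pi_{eq_quot term_eqv Q} (eval s t).
  by rewrite (eval_hom _ _ (free_algebra_pi Q)).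
rewrite /holds !ev => /free_valid Hp; apply/free_valid => A QA u.
rewrite /holds /= !(eval_hom s _ (eval_homomorphism u)).
apply: H => //; have := Hp A QA u.
by rewrite /holds /= !(eval_hom s _ (eval_homomorphism u)).
Qed.

(* Only the valid quasi-identities are assumed, because for these the free
   algebra inherits validity directly. *)
Lemma stone_quasi_identities (A : algebra) :
  (forall p q : identity,
     (forall B, stone_algebra B -> forall v : nat -> B, holds v p -> holds v q) ->
     forall v : nat -> A, holds v p -> holds v q) ->
  stone_algebra A.
Proof.
move=> H.
(* An identity is a quasi-identity with the trivial premise [Top] equal to [Top]. *)
have E s t : (forall B, stone_algebra B -> forall v : nat -> B, holds v (s, t)) ->
    forall v : nat -> A, eval v s = eval v t.
  by move=> He v; apply: (H (Top, Top) (s, t)) => // B SB w _; exact: He.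
pose v3 (a b c : A) i := nth a [:: a; b; c] i.
split; first split.
- move=> a b; apply: (E (Join (Var 0) (Var 1)) (Join (Var 1) (Var 0)) _ (v3 a b b)).
  by move=> B [L _ _ _] v; exact: joinC.
- move=> a b; apply: (E (Meet (Var 0) (Var 1)) (Meet (Var 1) (Var 0)) _ (v3 a b b)).
  by move=> B [L _ _ _] v; exact: meetC.
- move=> a b c; apply: (E (Join (Var 0) (Join (Var 1) (Var 2)))
    (Join (Join (Var 0) (Var 1)) (Var 2)) _ (v3 a b c)).
  by move=> B [L _ _ _] v; exact: joinA.
- move=> a b c; apply: (E (Meet (Var 0) (Meet (Var 1) (Var 2)))
    (Meet (Meet (Var 0) (Var 1)) (Var 2)) _ (v3 a b c)).
  by move=> B [L _ _ _] v; exact: meetA.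
- move=> a b; apply: (E (Join (Var 0) (Meet (Var 0) (Var 1))) (Var 0) _ (v3 a b b)).
  by move=> B [L _ _ _] v; exact: joinK.
- move=> a b; apply: (E (Meet (Var 0) (Join (Var 0) (Var 1))) (Var 0) _ (v3 a b b)).
  by move=> B [L _ _ _] v; exact: meetK.
- move=> a b c; apply: (E (Meet (Var 0) (Join (Var 1) (Var 2)))
    (Join (Meet (Var 0) (Var 1)) (Meet (Var 0) (Var 2))) _ (v3 a b c)).
  by move=> B [L _ _ _] v; exact: meet_joinr.
- move=> a; apply: (E (Join (Var 0) Bot) (Var 0) _ (v3 a a a)).
  by move=> B [L _ _ _] v; exact: join_bot.
- move=> a; apply: (E (Meet (Var 0) Top) (Var 0) _ (v3 a a a)).
  by move=> B [L _ _ _] v; exact: meet_top.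
- move=> a; apply: (E (Meet (Var 0) (Star (Var 0))) Bot _ (v3 a a a)).
  by move=> B S v; exact: meet_star.
(* Maximality of the pseudocomplement is stated with a genuine premise, so [H] is used directly. *)
- move=> a b; apply: (H (Meet (Var 0) (Var 1), Bot)
    (Meet (Var 1) (Star (Var 0)), Var 1) _ (v3 a b b)).
  by move=> B S v; exact: star_max.
- move=> a; apply: (E (Join (Star (Var 0)) (Star (Star (Var 0)))) Top _ (v3 a a a)).
  by move=> B S v; exact: stone_join.
Qed.

Lemma stone_free : stone_algebra (free_algebra stone_algebra).
Proof. by apply: stone_quasi_identities => p q; exact: free_quasi_identity. Qed.

Lemma free_nontrivial :
  top <> bot :> free_algebra stone_algebra.
Proof. by move=> /free_valid /(_ three stone_three (fun=> One)). Qed.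

(** A substitution followed by the projection is an assignment into the free algebra; an identity
    holds under it exactly when its substituted form is valid in [Q]. *)
Lemma satisfies_free_admissible (Q : class) (c : clause) :
  satisfies (free_algebra Q) c -> admissible Q c.
Proof.
move=> sat sigma hs Hp.
pose pi : term_algebra -> free_algebra Q := \pi_{eq_quot term_eqv Q}.
have eval_Var t : @eval term_algebra Var t = t.
  by elim: t => //= [s -> t ->|s -> t ->|s ->].
have ev t : eval (pi \o (sigma \o Var)) t = pi (sigma t).
  rewrite -(eval_hom _ _ (free_algebra_pi Q)).
  by rewrite -(@eval_hom term_algebra _ _ Var t hs) eval_Var.
have [e Ee|e Ee] := sat (pi \o (sigma \o Var)).
  by rewrite /holds !ev; apply/free_valid; exact: Hp.
by rewrite /holds !ev => /free_valid; exists e.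
Qed.

(** * Universal classes and the completeness results *)

Lemma satisfies_valid_stone (A : algebra) :
  (forall c, valid stone_algebra c -> satisfies A c) -> stone_algebra A.
Proof.
move=> H; apply: stone_quasi_identities => p q pq v hp.
have [B SB w|e|e] := H (Clause [fset p]%fset [fset q]%fset) _ v.
- by move=> Hp; exists q; rewrite ?inE //; apply: pq => //; apply: Hp; rewrite inE.
- by rewrite inE => /eqP ->.
- by rewrite inE => /eqP ->.
Qed.

Lemma satisfies_nontrivial (A : algebra) :
  satisfies A (Clause [fset (Top, Bot)]%fset fset0) <-> top <> bot :> A.
Proof.
split=> [H tb|ntriv v /(_ (Top, Bot))].
  by have [e|e] := H (fun=> top); rewrite inE // => /eqP ->.
by rewrite inE eqxx => /(_ isT) /ntriv.
Qed.

(** The models of any single clause already form a universal class. *)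
Lemma U_satisfies (B A : algebra) :
  U (eq B) A <-> forall c, satisfies B c -> satisfies A c.
Proof.
split=> [UA c Bc|H C [Lambda CL] CB].
- apply: (UA (fun D => satisfies D c)) => [|_ <- //].
  by exists (fun d => d = c) => D; split=> [Dc _ ->|]; last apply.
- by apply/CL => c Lc; apply: H; have /CL := CB B erefl; exact.
Qed.

Theorem theorem18 :
  [/\ nonneg_universally_complete stone_algebra,
      ~ universally_complete stone_algebra
    & admissible_basis stone_algebra
        [set Clause [fset (Top, Bot)]%fset fset0]%classic].
Proof.
split.
- move=> c nonneg; split=> [adm A S|val].
    (* In a trivial algebra all elements coincide, so any conclusion holds, and [nonneg] supplies
       one. *)
    have [triv|] := pselect (top = bot :> A); last first.
      by move=> ntriv; exact: admissible_satisfies.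
    have /fset0Pn[e De] := nonneg.
    by move=> v _; exists e => //; apply: eq_trivial (stone_lattice S) _ _ triv.
  by apply: satisfies_free_admissible; apply: val; exact: stone_free.
- move=> /(_ (Clause [fset (Top, Bot)]%fset fset0))[val _].
  (* The one-element Stone algebra refutes this clause, while non-triviality of the free algebra
     makes it admissible. *)
  pose one := @Algebra unit (fun _ _ => tt) (fun _ _ => tt) (fun=> tt) tt tt.
  have S1 : stone_algebra one by split; [split|..]; do ?case.
  have /val/(_ one S1)/satisfies_nontrivial :
      admissible stone_algebra (Clause [fset (Top, Bot)]%fset fset0).
    apply: satisfies_free_admissible; apply/satisfies_nontrivial.
    exact: free_nontrivial.
  exact.
- move=> A; split=> [/U_satisfies H|[S HA]].
    split=> [|_ ->]; last first.
      by apply: H; apply/satisfies_nontrivial; exact: free_nontrivial.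
    by apply: satisfies_valid_stone => c val; apply/H/val; exact: stone_free.
  apply/U_satisfies => c Fc; apply: admissible_satisfies => //.
    by apply/satisfies_nontrivial; exact: HA.
  exact: satisfies_free_admissible.
Qed.
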